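(* The binary relation $\unlhd$ is a partial order on $\mathbb{M}_{\mathrm{GHP}}$, and it obeys the following sandwich theorem: for all sequences $(\mathcal{X}^-_n)_{n\geq1}$, $(\mathcal{X}_n)_{n\geq1}$, $(\mathcal{X}^+_n)_{n\geq1}$ of elements of $\mathbb{M}_{\mathrm{GHP}}$ and all $\mathcal{X}_\infty\in\mathbb{M}_{\mathrm{GHP}}$, if $\mathcal{X}^-_n\unlhd\mathcal{X}_n\unlhd\mathcal{X}^+_n$ for every $n$, and $\mathcal{X}^-_n\to\mathcal{X}_\infty$ and $\mathcal{X}^+_n\to\mathcal{X}_\infty$ in the Gromov--Hausdorff--Prokhorov (GHP) topology, then $\mathcal{X}_n\to\mathcal{X}_\infty$ in the GHP topology.
   Context: $\mathbb{M}_{\mathrm{GHP}}$ is the set of measure-preserving isometry classes $[X,d,\mu]$ of compact metric measure spaces, i.e. triples $(X,d,\mu)$ with $(X,d)$ a compact metric space and $\mu$ a finite Borel measure on it; two such triples are identified if there is a bijection $\phi:X\to X'$ with $d'(\phi(x),\phi(y))=d(x,y)$ and $\phi_*\mu=\mu'$. For a metric space $(Z,\delta)$, the Hausdorff distance of compact $K,K'\subset Z$ is $\inf\{\epsilon>0: K\subset K'^\epsilon, K'\subset K^\epsilon\}$ with $A^\epsilon=\{z:\delta(z,A)<\epsilon\}$, and the Prokhorov distance of finite Borel measures $\mu,\mu'$ is $\inf\{\epsilon>0:\forall A \text{ Borel}, \mu(A)\le\mu'(A^\epsilon)+\epsilon,\ \mu'(A)\le\mu(A^\epsilon)+\epsilon\}$.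 The GHP distance between $(X,d,\mu)$ and $(X',d',\mu')$ is the infimum, over all metric spaces $(Z,\delta)$ and isometric embeddings $\phi:X\to Z$, $\phi':X'\to Z$, of the Hausdorff distance of $\phi(X),\phi'(X')$ plus the Prokhorov distance of $\phi_*\mu,\phi'_*\mu'$; it is a metric on $\mathbb{M}_{\mathrm{GHP}}$ inducing the GHP topology. For $\mathcal{X}=[X,d,\mu]$ and $\mathcal{X}'=[X',d',\mu']$, one writes $\mathcal{X}\unlhd\mathcal{X}'$ if there is a surjective map $\phi:X'\to X$ which is 1-Lipschitz ($d(\phi(x'),\phi(y'))\le d'(x',y')$ for all $x',y'\in X'$) and measure-contracting ($\mu(A)\le\mu'(\phi^{-1}(A))$ for every Borel subset $A$ of $X$). *)

(* Defs.v *)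
From HB Require Import structures.
From mathcomp Require Import all_boot all_order all_algebra.
From mathcomp Require Import all_classical all_reals topology normedtype sequences.
Set Implicit Arguments. Unset Strict Implicit. Unset Printing Implicit Defensive.
Import Order.TTheory GRing.Theory Num.Theory.
Import numFieldNormedType.Exports.
Local Open Scope classical_set_scope.
Local Open Scope ring_scope.

Section Defs.
Variable R : realType.

Definition is_metric (T : Type) (d : T -> T -> R) : Prop :=
  [/\ forall x y, d x y = 0 <-> x = y,
      forall x y, d x y = d y x &
      forall x y z, d x z <= d x y + d y z].

Definition mopen (T : Type) (d : T -> T -> R) (U : set T) : Prop :=
  forall x, U x -> exists2 r : R, 0 < r & [set y | d x y < r] `<=` U.

Definition is_sigma_algebra (T : Type) (S : set (set T)) : Prop :=
  [/\ S set0,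
      forall A, S A -> S (~` A) &
      forall F : nat -> set T, (forall n, S (F n)) -> S (\bigcup_n F n)].

Definition borel (T : Type) (d : T -> T -> R) (A : set T) : Prop :=
  forall S : set (set T), is_sigma_algebra S -> mopen d `<=` S -> S A.

Definition mcompact (T : Type) (d : T -> T -> R) : Prop :=
  forall (I : Type) (U : I -> set T), (forall i, mopen d (U i)) ->
    [set: T] `<=` \bigcup_i U i ->
    exists J : set I, finite_set J /\ [set: T] `<=` \bigcup_(i in J) U i.

(** Finite (real-valued) Borel measures: nonnegative, null on the empty set,
    and countably additive on Borel sets.  Values on non-Borel sets are
    irrelevant (never used). *)
Definition is_finite_borel_measure (T : Type) (d : T -> T -> R)
    (mu : set T -> R) : Prop :=
  [/\ forall A, borel d A -> 0 <= mu A,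
      mu set0 = 0 &
      forall F : nat -> set T, (forall n, borel d (F n)) ->
        (forall i j, i <> j -> F i `&` F j = set0) ->
        (fun n => \sum_(i < n) mu (F i)) @ \oo --> mu (\bigcup_n F n)].

(** A compact metric measure space (a representative of an element of M_GHP). *)
Record cmms := CMMS {
  cm_carrier :> Type;
  cm_dist : cm_carrier -> cm_carrier -> R;
  cm_meas : set cm_carrier -> R;
  cm_metric : is_metric cm_dist;
  cm_compact : mcompact cm_dist;
  cm_measure : is_finite_borel_measure cm_dist cm_meas }.

Record mspace := MSpace {
  ms_carrier :> Type;
  ms_dist : ms_carrier -> ms_carrier -> R;
  ms_metric : is_metric ms_dist }.

(** Measure-preserving isometry classes: X and X' are identified. *)
Definition cmms_iso (X X' : cmms) : Prop :=
  exists phi : X -> X', bijective phi /\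
    (forall x y, @cm_dist X' (phi x) (phi y) = @cm_dist X x y) /\
    (forall A : set X', borel (@cm_dist X') A ->
       @cm_meas X (phi @^-1` A) = @cm_meas X' A).

Definition cmms_le (X X' : cmms) : Prop :=
  exists phi : X' -> X,
    [/\ forall x, exists x', phi x' = x,
        (forall x' y', @cm_dist X (phi x') (phi y') <= @cm_dist X' x' y') &
        (forall A : set X, borel (@cm_dist X) A ->
           @cm_meas X A <= @cm_meas X' (phi @^-1` A))].

Definition nbhd_eps (Z : mspace) (A : set Z) (e : R) : set Z :=
  [set z | exists2 a, A a & @ms_dist Z z a < e].

Definition hausdorff_dist (Z : mspace) (K K' : set Z) : R :=
  inf [set e : R | 0 < e /\ K `<=` nbhd_eps K' e /\ K' `<=` nbhd_eps K e].

Definition prokhorov_dist (Z : mspace) (mu mu' : set Z -> R) : R :=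
  inf [set e : R | 0 < e /\ forall A : set Z, borel (@ms_dist Z) A ->
        mu A <= mu' (nbhd_eps A e) + e /\ mu' A <= mu (nbhd_eps A e) + e].

Definition isometric_embedding (X : cmms) (Z : mspace) (phi : X -> Z) :=
  forall x y, @ms_dist Z (phi x) (phi y) = @cm_dist X x y.

Definition pushforward (X : cmms) (Z : mspace) (phi : X -> Z) : set Z -> R :=
  fun A => @cm_meas X (phi @^-1` A).

Definition ghp_dist (X X' : cmms) : R :=
  inf [set r : R | exists (Z : mspace) (phi : X -> Z) (phi' : X' -> Z),
         [/\ isometric_embedding phi, isometric_embedding phi' &
             r = hausdorff_dist (range phi) (range phi')
                 + prokhorov_dist (pushforward phi) (pushforward phi')]].

Definition ghp_cvg (Xs : nat -> cmms) (X : cmms) : Prop :=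
  (fun n => ghp_dist (Xs n) X) @ \oo --> (0 : R).

End Defs.

(* Main.v *)
(** A surjective 1-Lipschitz self-map of a compact metric space is an isometry,
    and this holds quantitatively: an almost surjective, almost 1-Lipschitz
    self-map is an almost isometry.  The exact version gives antisymmetry (equality
    of the measures follows by passing to complements).  For the sandwich, the
    composite Xinf ~ Xp n -> X n -> Xm n ~ Xinf is such a self-map, so Xp n -> X n
    almost preserves distances; moreover the image of the measure of Xp n exceeds
    that of X n by a measure of mass at most mass(Xp n) - mass(Xm n), which tends
    to 0.  So X n is close to Xp n, hence to Xinf, and no compactness of the space
    of compact metric measure spaces is needed.

    Since the infimum of the empty set is 0, the Hausdorff distance between an
    empty and a nonempty set is 0, and when one carrier is empty the GHP distance
    is the difference of the total masses; this case is treated separately. *)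
Require Import Defs.
From HB Require Import structures.
From mathcomp Require Import all_boot all_order all_algebra.
From mathcomp Require Import all_classical all_reals topology normedtype sequences.
From mathcomp Require Import zify lra.
Set Implicit Arguments. Unset Strict Implicit. Unset Printing Implicit Defensive.
Import Order.TTheory GRing.Theory Num.Theory.
Import numFieldNormedType.Exports.
Local Open Scope classical_set_scope.
Local Open Scope ring_scope.

(** * Compact metric spaces: finite partitions, boundedness, almost isometries *)

Lemma metric_refl (R : realType) (T : Type) (d : T -> T -> R) :
  is_metric d -> forall x, d x x = 0.
Proof. by case=> d0 _ _ x; apply/d0. Qed.

Lemma metric_ge0 (R : realType) (T : Type) (d : T -> T -> R) :
  is_metric d -> forall x y, 0 <= d x y.
Proof.
move=> dm x y; have [_ dC dT] := dm.
have := dT x y x; rewrite (dC y x) (metric_refl dm); lra.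
Qed.

Lemma ball_mopen (R : realType) (T : Type) (d : T -> T -> R) :
  is_metric d -> forall x (r : R), mopen d [set y | d x y < r].
Proof.
case=> _ _ dT x r y /= xy; exists (r - d x y); first by rewrite subr_gt0.
by move=> z /= yz; have := dT x y z; lra.
Qed.

(** Each point is coloured by the centre of a ball of radius [e / 2] containing it, taken from a
    finite subcover. The colouring form is suited to pigeonhole arguments. *)
Lemma mcompact_totally_bounded (R : realType) (T : Type) (d : T -> T -> R) :
  is_metric d -> mcompact d -> forall e : R, 0 < e ->
  exists N (c : T -> 'I_N), forall x y, c x = c y -> d x y < e.
Proof.
move=> dm dK e e0; have [_ dC dT] := dm.
have [||J [[N /pcard_eqP /unsquash f] Jcov]] := dK T (fun x => [set y | d x y < e / 2]).
- by move=> i; exact: ball_mopen.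
- by move=> x _; exists x => //=; rewrite (metric_refl dm); lra.
have pick x : exists i, J i /\ d i x < e / 2 by have [i Ji xi] := Jcov x I; exists i.
have [t tP] := choice pick.
have lt x : (f (t x) < N)%N by have := @funS _ _ _ _ f _ (tP x).1.
exists N, (fun x => Ordinal (lt x)) => x y /(congr1 val) /= fxy.
have txy : t x = t y.
  exact: inj (mem_set (tP x).1) (mem_set (tP y).1) fxy.
have := (tP x).2; have := (tP y).2; have := dT x (t y) y.
by rewrite txy (dC x (t y)); lra.
Qed.

Lemma mcompact_bounded (R : realType) (T : Type) (d : T -> T -> R) :
  is_metric d -> mcompact d -> exists M : R, forall x y, d x y <= M.
Proof.
move=> dm dK; have [_ dC dT] := dm.
have [N [c cP]] := mcompact_totally_bounded dm dK ltr01.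
(* Some colours may be taken by no point, hence the option. *)
have rep (i : 'I_N) : exists o : option T,
    forall x, c x = i -> exists2 y, o = Some y & c y = i.
  have [[x cx]|none] := pselect (exists x, c x = i).
    by exists (Some x) => _ _; exists x.
  by exists None => x cx; case: none; exists x.
have [r rP] := choice rep.
pose D (i j : 'I_N) : R :=
  if r i is Some x then if r j is Some y then d x y else 0 else 0.
have D0 i j : 0 <= D i j.
  by rewrite /D; case: (r i) => // a; case: (r j) => // b; exact: metric_ge0.
exists (2 + \sum_i \sum_j D i j) => x y.
have [x' rx cx] := rP _ x erefl; have [y' ry cy] := rP _ y erefl.
have := cP x x' (esym cx); have := cP y' y cy.
have : d x' y' <= \sum_i \sum_j D i j.
  rewrite (bigD1 (c x)) //= (bigD1 (c y)) //= {1}/D rx ry -addrA lerDl addr_ge0 //.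
    by apply: sumr_ge0.
  by apply: sumr_ge0 => i _; apply: sumr_ge0.
by have := dT x x' y; have := dT x' y' y; lra.
Qed.

(* Let [g] be an approximate section of [s]: it is almost expanding, so by
   pigeonhole along its orbits a common iterate [g^(k+1)] almost fixes both [x]
   and [y]; hence [g], and then [s], cannot distort their distance much. *)
Lemma almost_isometry (R : realType) (T : Type) (d : T -> T -> R) :
  is_metric d -> mcompact d -> forall delta : R, 0 < delta ->
  exists2 e : R, 0 < e & forall s : T -> T,
    (forall x y, d (s x) (s y) <= d x y + e) ->
    (forall y, exists x, d (s x) y <= e) ->
    forall x y, d x y <= d (s x) (s y) + delta.
Proof.
move=> dm dK delta delta0; have [_ dC dT] := dm.
(* The final chain of triangle inequalities loses at most [13 * h + 4 * e], within [17 * h] because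
   [3 * e <= h]. *)
pose h := delta / 17; have h0 : 0 < h by rewrite /h; lra.
have [N [c cP]] := mcompact_totally_bounded dm dK h0.
(* [K] counts the pairs of colours, so [K.+1] iterates suffice for a collision. Each application of
   [g] may shrink a distance by [3 * e], and [e] keeps the total loss over [K] applications below
   [h]. *)
pose K := #|{: 'I_N * 'I_N}|; pose e := h / (3 * K.+1%:R).
have K0 : 0 < K.+1%:R :> R by rewrite ltr0n.
have e0 : 0 < e by rewrite divr_gt0 // mulr_gt0.
have eK k : (k <= K)%N -> 3 * e * k%:R <= h.
  move=> kK; have -> : h = 3 * e * K.+1%:R.
    by rewrite /e mulrAC mulrCA divff ?mulr1 //; lra.
  by rewrite ler_pM2l ?ler_nat ?leqW //; lra.
have e_h : 3 * e <= h.
  have := @eK 1%N; have [K0'|_] := posnP K; last by rewrite mulr1; exact.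
  move=> _; rewrite /e K0' mulr1 mulrCA divff ?mulr1 //; lra.
exists e => // s sL /choice[g gP] x y.
have gE a b : d a b <= d (g a) (g b) + 3 * e.
  have := sL (g a) (g b); have := gP a; have := gP b.
  have := dT a (s (g a)) b; have := dT (s (g a)) (s (g b)) b.
  by rewrite (dC a (s (g a))); lra.
have itE k a b : d a b <= d (iter k g a) (iter k g b) + 3 * e * k%:R.
  elim: k => [|k IH] /=; first by lra.
  by have := gE (iter k g a) (iter k g b); rewrite -natr1; lra.
(* If the iterates [i < j] share their colours at [a] and at [b], the almost expansion of [iter i g]
   carries this closeness back to [a] and [iter (j - i) g a]: one [h] for the colour, one for the
   loss. *)
have recur a b : exists k, [/\ (k < K)%N, d a (iter k.+1 g a) <= 2 * h
    & d b (iter k.+1 g b) <= 2 * h].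
  pose code (i : 'I_K.+1) := (c (iter i g a), c (iter i g b)).
  have /injectivePn[i [j ij [ca cb]]] : ~~ injectiveb code.
    by apply/negP => /injectiveP /leq_card; rewrite card_ord ltnn.
  wlog lt_ij : i j ij ca cb / (i < j)%N => [W|].
    have [lt|lt|/val_inj E] := ltngtP i j; first exact: (W i j).
      by apply: (W j i); rewrite // eq_sym.
    by rewrite E eqxx in ij.
  have jE : (j = i + (j - i.+1).+1 :> nat)%N by rewrite addnS -addSn subnKC.
  have iK : (i <= K)%N by rewrite -ltnS.
  exists (j - i.+1)%N; split.
  - by have := ltn_ord j; move: lt_ij; lia.
  - have := itE i a (iter (j - i.+1).+1 g a); rewrite -iterD -jE.
    by have := cP _ _ ca; have := eK _ iK; lra.
  - have := itE i b (iter (j - i.+1).+1 g b); rewrite -iterD -jE.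
    by have := cP _ _ cb; have := eK _ iK; lra.
(* A large expansion by one step of [g] would survive the next [k] steps, yet the iterate [k.+1]
   brings both points back within [2 * h]. *)
have gU a b : d (g a) (g b) <= d a b + 5 * h.
  have [k [kK ka kb]] := recur a b.
  have := itE k (g a) (g b); rewrite -!iterSr.
  have := eK _ (ltnW kK).
  have := dT (iter k.+1 g a) a (iter k.+1 g b); have := dT a b (iter k.+1 g b).
  by rewrite (dC (iter k.+1 g a) a); lra.
(* Now [x] is close to [g x'], so [s x] is close to [s (g x')] and hence to [x']; likewise for [y].
   Thus [d (s x) (s y)] is compared with [d x' y'], and [gU] leads back to [d x y]. *)
have [k [_ /= kx ky]] := recur x y.
set x' := iter k g x in kx; set y' := iter k g y in ky.
have := gU x' y'.
have := gP x'; have := gP y'.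
have := sL x (g x'); have := sL y (g y').
have := dT x (g x') y; have := dT (g x') (g y') y; rewrite (dC (g y') y).
have := dT x' (s (g x')) y'; have := dT (s (g x')) (s (g y')) y'.
have := dT (s (g x')) (s x) (s (g y')); have := dT (s x) (s y) (s (g y')).
rewrite (dC x' (s (g x'))) (dC (s (g x')) (s x)).
have : delta = 17 * h by rewrite /h; lra.
lra.
Qed.

(** * Borel sets and finite Borel measures *)

Lemma borel_sigma_algebra (R : realType) (T : Type) (d : T -> T -> R) :
  is_sigma_algebra (borel d).
Proof.
split=> [S [? _ _] _ //|A bA S SA dS|F bF S SA dS].
  by have [_ + _] := SA; apply; exact: bA.
by have [_ _] := SA; apply => n; exact: bF.
Qed.

Lemma mopen_borel (R : realType) (T : Type) (d : T -> T -> R) A :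
  mopen d A -> borel d A.
Proof. by move=> oA S _; exact. Qed.

Lemma borelC (R : realType) (T : Type) (d : T -> T -> R) A :
  borel d A -> borel d (~` A).
Proof. by have [_ + _] := borel_sigma_algebra d; exact. Qed.

Lemma borel0 (R : realType) (T : Type) (d : T -> T -> R) : borel d set0.
Proof. by have [] := borel_sigma_algebra d. Qed.

Lemma borelT (R : realType) (T : Type) (d : T -> T -> R) : borel d setT.
Proof. by rewrite -setC0; apply: borelC; exact: borel0. Qed.

Lemma borelU (R : realType) (T : Type) (d : T -> T -> R) A B :
  borel d A -> borel d B -> borel d (A `|` B).
Proof.
move=> bA bB; have [_ _ bU] := borel_sigma_algebra d.
have -> : A `|` B = \bigcup_n (if n == 0%N then A else B).
  apply/seteqP; split=> [x [Ax|Bx]|x [[|n] _ /= ?]]; [| |by left|by right].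
  - by exists 0%N.
  - by exists 1%N.
by apply: bU => -[|n].
Qed.

(** The sets whose preimage lies in a given sigma-algebra form a sigma-algebra; it contains the open
    sets because a 1-Lipschitz map is continuous. *)
Lemma borel_preimage (R : realType) (T T' : Type) (d : T -> T -> R)
    (d' : T' -> T' -> R) (f : T -> T') :
  (forall x y, d' (f x) (f y) <= d x y) ->
  forall A, borel d' A -> borel d (f @^-1` A).
Proof.
move=> fL A bA S [S0 SC SU] dS.
apply: (bA (fun B => S (f @^-1` B))) => [|U oU].
  split=> [|B SB|F SF]; first by rewrite preimage_set0.
    by rewrite preimage_setC; exact: SC.
  by rewrite preimage_bigcup; exact: SU.
apply: dS => x /oU[r r0 rU]; exists r => // y /= xy.
by apply: rU => /=; exact: le_lt_trans (fL _ _) xy.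
Qed.

Section FiniteBorelMeasure.
Variables (R : realType) (T : Type) (d : T -> T -> R) (mu : set T -> R).
Hypothesis muP : is_finite_borel_measure d mu.

Lemma borel_measureU A B : borel d A -> borel d B -> A `&` B = set0 ->
  mu (A `|` B) = mu A + mu B.
Proof.
move=> bA bB AB0; have [_ mu0 muU] := muP.
(* Countable additivity is applied to [A], [B], [set0], [set0], ..., whose partial sums are constant
   from index 2 on. *)
pose F n := if n is n'.+1 then (if n' is _.+1 then set0 else B) else A.
have -> : A `|` B = \bigcup_n F n.
  apply/seteqP; split=> [x [Ax|Bx]|x [[|[|n]] _ //= ?]]; [| |by left|by right].
  - by exists 0%N.
  - by exists 1%N.
have Fb n : borel d (F n) by case: n => [|[|n]] //=; exact: borel0.
have Fd i j : i <> j -> F i `&` F j = set0.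
  by case: i j => [|[|i]] [|[|j]] //= _; rewrite ?set0I ?setI0 // setIC.
have cvgF := muU F Fb Fd.
apply: (cvg_unique _ cvgF) => //.
apply/cvgrPdist_lt => e e0; near=> n.
have -> : \sum_(i < n) mu (F i) = mu A + mu B.
  have -> : n = (n - 2).+2 by rewrite -addn2 subnK //; near: n; exists 2%N.
  rewrite !big_ord_recl /= big1 ?addr0 //.
by rewrite subrr normr0.
Unshelve. all: by end_near.
Qed.

Lemma borel_measureC A : borel d A -> mu (~` A) = mu setT - mu A.
Proof.
move=> bA; have := borel_measureU bA (borelC bA) (setICr A).
by rewrite setUv => ->; rewrite addrC addKr.
Qed.

Lemma borel_measure_le A B : borel d A -> borel d B -> A `<=` B -> mu A <= mu B.
Proof.
move=> bA bB AB; have [mu0 _ _] := muP.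
have bD : borel d (~` (~` B `|` A)) by apply: borelC; apply: borelU => //; exact: borelC.
have -> : B = A `|` ~` (~` B `|` A).
  rewrite setCU setCK; apply/seteqP; split=> x.
    by move=> Bx; have [Ax|nAx] := pselect (A x); [left|right].
  by case=> [/AB|[]].
rewrite borel_measureU ?lerDl ?mu0 //.
by apply/seteqP; split=> x // -[Ax []]; right.
Qed.

End FiniteBorelMeasure.

(** * The partial order on isometry classes *)

Lemma cmms_le_refl (R : realType) (X : cmms R) : cmms_le X X.
Proof. by exists id; split=> // x; exists x. Qed.

Lemma cmms_le_trans (R : realType) (X Y Z : cmms R) :
  cmms_le X Y -> cmms_le Y Z -> cmms_le X Z.
Proof.
move=> [f [fS fL fm]] [g [gS gL gm]]; exists (f \o g); split.
- by move=> x; have [y <-] := fS x; have [z <-] := gS y; exists z.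
- by move=> x y; exact: le_trans (fL _ _) (gL _ _).
- move=> A bA; rewrite comp_preimage; apply: le_trans (fm A bA) (gm _ _).
  exact: borel_preimage fL _ bA.
Qed.

Lemma cmms_iso_le (R : realType) (X Y : cmms R) :
  cmms_iso X Y -> cmms_le X Y /\ cmms_le Y X.
Proof.
move=> [f [[g fK gK] [fE fm]]]; have gE x y : cm_dist (g x) (g y) = cm_dist x y.
  by rewrite -fE !gK.
split; [exists g|exists f]; split.
- by move=> x; exists (f x).
- by move=> x y; rewrite gE.
- move=> A bA; rewrite -fm; last by apply: borel_preimage bA => x y; rewrite gE.
  by rewrite -comp_preimage (_ : g \o f = id) //; apply/funext.
- by move=> y; exists (g y).
- by move=> x y; rewrite fE.
- by move=> A /fm ->.
Qed.

Lemma cmms_le_antisym (R : realType) (X Y : cmms R) :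
  cmms_le X Y -> cmms_le Y X -> cmms_iso X Y.
Proof.
move=> [f [fS fL fm]] [g [gS gL gm]].
have [dX dY] := (cm_metric X, cm_metric Y).
(* The self-map [f \o g] of [X] is exactly surjective and 1-Lipschitz, so [almost_isometry] applies
   to it for every error [e]. *)
have gE x y : cm_dist (g x) (g y) = cm_dist x y.
  apply/eqP; rewrite eq_le gL /=; apply/ler_addgt0Pr => e e0.
  have [h h0 hP] := almost_isometry dX (@cm_compact _ X) e0.
  have fgL a b := le_trans (fL (g a) (g b)) (gL a b).
  apply: (le_trans (hP (f \o g) _ _ x y)).
  - by move=> a b /=; have := fgL a b; lra.
  - move=> a; have [b <-] := fS a; have [c <-] := gS b.
    by exists c; rewrite /= (metric_refl dX) ltW.
  - by rewrite lerD2r; exact: fL.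
have g_inj : injective g.
  move=> x y gxy; have [d0 _ _] := dX; apply/d0.
  by rewrite -gE gxy (metric_refl dY).
exists g; split; [|split=> // A bA].
  have [k kP] := choice gS; exists k => // x.
  by apply: g_inj; rewrite kP.
have gb B : borel (@cm_dist _ Y) B -> borel (@cm_dist _ X) (g @^-1` B).
  exact: borel_preimage.
apply/eqP; rewrite eq_le gm // andbT.
have := gm _ (borelC bA); rewrite preimage_setC.
rewrite (borel_measureC (cm_measure X)) ?(borel_measureC (cm_measure Y)) //; last exact: gb.
(* The mass inequality from [f] turns the bound of [g] on the complement of [A] into the missing
   bound on [A]. *)
have := fm setT (@borelT _ _ _); rewrite preimage_setT; lra.
Qed.

Lemma cmms_le_iso (R : realType) (X X' Y Y' : cmms R) :
  cmms_iso X X' -> cmms_iso Y Y' -> (cmms_le X Y <-> cmms_le X' Y').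
Proof.
move=> /cmms_iso_le[XX' X'X] /cmms_iso_le[YY' Y'Y]; split=> le.
  exact: cmms_le_trans X'X (cmms_le_trans le YY').
exact: cmms_le_trans XX' (cmms_le_trans le Y'Y).
Qed.

(** * Couplings and their relation to the GHP distance *)

(** The cross part of a pseudometric on the disjoint union that extends [d] and [d']; it may
    vanish. *)
Definition is_coupling (R : realType) (T U : Type) (d : T -> T -> R)
    (d' : U -> U -> R) (c : T -> U -> R) : Prop :=
  [/\ (forall x y, 0 <= c x y),
      (forall x x' y, d x x' <= c x y + c x' y),
      (forall x y y', d' y y' <= c x y + c x y'),
      (forall x x' y, c x y <= d x x' + c x' y) &
      (forall x y y', c x y <= c x y' + d' y' y)].

(** The Hausdorff and Prokhorov conditions at a common radius [e], read through the cross distance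
    [c] without an ambient space. *)
Definition eps_close (R : realType) (X Y : cmms R) (c : X -> Y -> R) (e : R) : Prop :=
  [/\ (forall x, exists y, c x y < e),
      (forall y, exists x, c x y < e),
      (forall A, borel (@cm_dist R X) A ->
        cm_meas A <= cm_meas [set y | exists2 x, A x & c x y < e] + e) &
      (forall B, borel (@cm_dist R Y) B ->
        cm_meas B <= cm_meas [set x | exists2 y, B y & c x y < e] + e)].

Definition sum_dist (R : realType) (T U : Type) (d : T -> T -> R)
    (d' : U -> U -> R) (c : T -> U -> R) (x y : T + U) : R :=
  match x, y with
  | inl a, inl b => d a b
  | inr a, inr b => d' a b
  | inl a, inr b | inr b, inl a => c a b
  end.

Lemma sum_dist_metric (R : realType) (T U : Type) (d : T -> T -> R)
    (d' : U -> U -> R) (c : T -> U -> R) :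
  is_metric d -> is_metric d' -> is_coupling d d' c ->
  (forall x y, 0 < c x y) -> is_metric (sum_dist d d' c).
Proof.
move=> [d0 dC dT] [d'0 d'C d'T] [_ c1 c2 c3 c4] cpos; split.
- move=> [x|x] [y|y] /=; split=> [/eqP|//]; rewrite ?(gt_eqF (cpos _ _)) //.
  + by move=> /eqP /d0 ->.
  + by move=> [->]; apply/d0.
  + by move=> /eqP /d'0 ->.
  + by move=> [->]; apply/d'0.
- by move=> [x|x] [y|y] /=.
- move=> [x|x] [y|y] [z|z] //=.
  + by rewrite addrC dC.
  + by rewrite addrC d'C.
Qed.

Lemma inf_ge0 (R : realType) (E : set R) : (forall x, E x -> 0 <= x) -> 0 <= inf E.
Proof.
move=> E0; have [->|/set0P E_neq0] := eqVneq E set0; first by rewrite inf0.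
exact: lb_le_inf.
Qed.

Lemma mopen_nbhd_eps (R : realType) (Z : mspace R) (A : set Z) (e : R) :
  mopen (@ms_dist R Z) (nbhd_eps A e).
Proof.
move=> z [a Aa za]; exists (e - ms_dist z a); first by rewrite subr_gt0.
have [_ dC dT] := ms_metric Z.
move=> w /= zw; exists a => //; have := dT w z a; rewrite (dC w z); lra.
Qed.

Lemma borel_nbhd_eps (R : realType) (Z : mspace R) (A : set Z) (e : R) :
  borel (@ms_dist R Z) (nbhd_eps A e).
Proof. by apply: mopen_borel; exact: mopen_nbhd_eps. Qed.

Lemma mopen_coupling_r (R : realType) (T U : Type) (d : T -> T -> R)
    (d' : U -> U -> R) (c : T -> U -> R) (A : set T) (e : R) :
  is_coupling d d' c -> mopen d' [set y | exists2 x, A x & c x y < e].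
Proof.
move=> [_ _ _ _ c4] y [x Ax xy]; exists (e - c x y); first by rewrite subr_gt0.
by move=> y' /= yy'; exists x => //; have := c4 x y' y; lra.
Qed.

Lemma is_coupling_sym (R : realType) (T U : Type) (d : T -> T -> R)
    (d' : U -> U -> R) (c : T -> U -> R) :
  is_metric d -> is_metric d' ->
  is_coupling d d' c -> is_coupling d' d (fun y x => c x y).
Proof.
move=> [_ dC _] [_ d'C _] [c0 c1 c2 c3 c4]; split=> // x y z.
  by rewrite addrC d'C.
by rewrite addrC dC.
Qed.

Lemma mopen_coupling_l (R : realType) (T U : Type) (d : T -> T -> R)
    (d' : U -> U -> R) (c : T -> U -> R) (B : set U) (e : R) :
  is_metric d -> is_metric d' ->
  is_coupling d d' c -> mopen d [set x | exists2 y, B y & c x y < e].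
Proof. by move=> dm dm' cc; exact: mopen_coupling_r (is_coupling_sym dm dm' cc). Qed.

(** The disjoint union metrized by [c] is a common ambient space; its Hausdorff and Prokhorov terms
    contribute [e] each. *)
Lemma ghp_dist_le (R : realType) (X Y : cmms R) (c : X -> Y -> R) (e : R) :
  0 < e -> is_coupling (@cm_dist R X) (@cm_dist R Y) c ->
  (forall x y, 0 < c x y) -> eps_close c e -> ghp_dist X Y <= e + e.
Proof.
move=> e0 cc cpos [XY YX mXY mYX].
pose Z := MSpace (sum_dist_metric (cm_metric X) (cm_metric Y) cc cpos).
pose inX : X -> Z := inl; pose inY : Y -> Z := inr.
have bX A : borel (@ms_dist R Z) A -> borel (@cm_dist R X) (inX @^-1` A).
  exact: borel_preimage.
have bY A : borel (@ms_dist R Z) A -> borel (@cm_dist R Y) (inY @^-1` A).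
  exact: borel_preimage.
apply: (@le_trans _ _ (hausdorff_dist (range inX) (range inY)
    + prokhorov_dist (pushforward inX) (pushforward inY))).
  apply: ge_inf; last by exists Z, inX, inY.
  exists 0 => r [W [f [g [_ _ ->]]]].
  by apply: addr_ge0; apply: inf_ge0 => t [/ltW].
apply: lerD; apply: ge_inf; try by exists 0 => t [/ltW].
  split=> //; split=> [_ [x _ <-]|_ [y _ <-]].
    by have [y xy] := XY x; exists (inY y) => //; exists y.
  by have [x xy] := YX y; exists (inX x) => //; exists x.
split=> // A bA; split.
  apply: le_trans (mXY _ (bX _ bA)) _; rewrite lerD2r.
  apply: (borel_measure_le (cm_measure Y)); [|exact: bY (borel_nbhd_eps _ _)|].
    by apply: mopen_borel; exact: (mopen_coupling_r cc).
  by move=> y [x Ax xy]; exists (inX x).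
apply: le_trans (mYX _ (bY _ bA)) _; rewrite lerD2r.
apply: (borel_measure_le (cm_measure X)); [|exact: bX (borel_nbhd_eps _ _)|].
  by apply: mopen_borel; exact: (mopen_coupling_l (cm_metric X) (cm_metric Y) cc).
by move=> x [y Ay xy]; exists (inY y).
Qed.

Lemma pushforward_le (R : realType) (X : cmms R) (Z : mspace R) (f : X -> Z) A B :
  isometric_embedding f -> borel (@ms_dist R Z) A -> borel (@ms_dist R Z) B ->
  A `<=` B -> pushforward f A <= pushforward f B.
Proof.
move=> fE bA bB AB; apply: (borel_measure_le (cm_measure X)).
- by apply: borel_preimage bA => x y; rewrite fE.
- by apply: borel_preimage bB => x y; rewrite fE.
- by move=> x /AB.
Qed.

Lemma pushforward_ge0 (R : realType) (X : cmms R) (Z : mspace R) (f : X -> Z) A :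
  isometric_embedding f -> borel (@ms_dist R Z) A -> 0 <= pushforward f A.
Proof.
move=> fE bA; have [+ _ _] := cm_measure X; apply.
by apply: borel_preimage bA => x y; rewrite fE.
Qed.

(** Guards against the infimum of the empty set. A radius exceeding both total masses makes the
    inequalities trivial. *)
Lemma prokhorov_dist_set_neq0 (R : realType) (X Y : cmms R) (Z : mspace R)
    (f : X -> Z) (g : Y -> Z) :
  isometric_embedding f -> isometric_embedding g ->
  [set p : R | 0 < p /\ forall A : set Z, borel (@ms_dist R Z) A ->
    pushforward f A <= pushforward g (nbhd_eps A p) + p /\
    pushforward g A <= pushforward f (nbhd_eps A p) + p] !=set0.
Proof.
move=> fE gE; pose p := 1 + pushforward f setT + pushforward g setT.
have fT := pushforward_ge0 fE (@borelT _ _ _).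
have gT := pushforward_ge0 gE (@borelT _ _ _).
exists p; split=> [|A bA]; first by rewrite /p; lra.
have := pushforward_le fE bA (@borelT _ _ _) (@subsetT _ A).
have := pushforward_le gE bA (@borelT _ _ _) (@subsetT _ A).
have := pushforward_ge0 fE (borel_nbhd_eps A p).
have := pushforward_ge0 gE (borel_nbhd_eps A p).
by rewrite /p; split; lra.
Qed.

(** Two nonempty spaces are joined by a bridge of length 1 between base points; if one is empty, the
    other serves as [Z]. *)
Lemma ex_common_embedding (R : realType) (X Y : cmms R) :
  exists (Z : mspace R) (f : X -> Z) (g : Y -> Z),
    isometric_embedding f /\ isometric_embedding g.
Proof.
have [[x0 _]|X0] := pselect (exists x : X, True); last first.
  have f (x : X) : Y by case: X0; exists x.
  exists (MSpace (cm_metric Y)), f, id; split=> // x.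
  by case: X0; exists x.
have [[y0 _]|Y0] := pselect (exists y : Y, True); last first.
  have f (y : Y) : X by case: Y0; exists y.
  exists (MSpace (cm_metric X)), id, f; split=> // y.
  by case: Y0; exists y.
have [mX mY] := (cm_metric X, cm_metric Y).
have [[_ dXC dXT] [_ dYC dYT]] := (mX, mY).
pose c (x : X) (y : Y) : R := 1 + cm_dist x x0 + cm_dist y0 y.
have cpos x y : 0 < c x y.
  by rewrite /c; have := metric_ge0 mX x x0; have := metric_ge0 mY y0 y; lra.
have cc : is_coupling (@cm_dist R X) (@cm_dist R Y) c.
  split=> [x y|x x' y|x y y'|x x' y|x y y']; rewrite /c.
  - exact/ltW/cpos.
  - have := metric_ge0 mY y0 y; have := dXT x x0 x'; rewrite (dXC x0 x'); lra.
  - have := metric_ge0 mX x x0; have := dYT y y0 y'; rewrite (dYC y y0); lra.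
  - have := dXT x x' x0; lra.
  - have := dYT y0 y' y; lra.
exists (MSpace (sum_dist_metric mX mY cc cpos)), inl, inr; split=> //.
Qed.

(** The coupling is the cross distance in an embedding of cost below [e]. The base points ensure
    that some Hausdorff radius is admissible, so that the infimum is not the default 0. *)
Lemma ghp_dist_lt (R : realType) (X Y : cmms R) (x0 : X) (y0 : Y) (e : R) :
  ghp_dist X Y < e -> exists2 c : X -> Y -> R,
    is_coupling (@cm_dist R X) (@cm_dist R Y) c & eps_close c e.
Proof.
have [mX mY] := (cm_metric X, cm_metric Y).
move=> /inf_lt[|_ [Z [f [g [fE gE ->]]]] lt_e].
  have [Z [f [g [fE gE]]]] := ex_common_embedding X Y.
  by eexists; exists Z, f, g; split.
have mZ := ms_metric Z; have [_ dC dT] := mZ.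
pose c x y := ms_dist (f x) (g y).
have cc : is_coupling (@cm_dist R X) (@cm_dist R Y) c.
  split=> [x y|x x' y|x y y'|x x' y|x y y']; rewrite /c -?fE -?gE //.
  - exact: metric_ge0.
  - by rewrite (dC (f x')).
  - by rewrite (dC (f x)).
have H0 : 0 <= hausdorff_dist (range f) (range g) by apply: inf_ge0 => t [/ltW].
have P0 : 0 <= prokhorov_dist (pushforward f) (pushforward g).
  by apply: inf_ge0 => t [/ltW].
exists c => //.
have [h hH h_e] : exists2 h, [set h : R | 0 < h /\ range f `<=` nbhd_eps (range g) h
    /\ range g `<=` nbhd_eps (range f) h] h & h < e.
  apply: inf_lt; last by apply: le_lt_trans lt_e; rewrite lerDl.
  have [M MP] := mcompact_bounded mX (@cm_compact _ X).
  have [M' MP'] := mcompact_bounded mY (@cm_compact _ Y).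
  have M0 := MP x0 x0; have M'0 := MP' y0 y0.
  rewrite (metric_refl mX) in M0; rewrite (metric_refl mY) in M'0.
  have c0 := metric_ge0 mZ (f x0) (g y0).
  exists (1 + M + M' + c x0 y0); split; first by rewrite /c; lra.
  split=> [_ [x _ <-]|_ [y _ <-]].
    exists (g y0); first by exists y0.
    have := dT (f x) (f x0) (g y0); rewrite fE; have := MP x x0.
    by rewrite /c; lra.
  exists (f x0); first by exists x0.
  have := dT (g y) (g y0) (f x0); rewrite gE (dC _ (f x0)); have := MP' y y0.
  by rewrite /c (dC _ (f x0)); lra.
have [p [p0 pP] p_e] : exists2 p, [set p : R | 0 < p /\
    forall A : set Z, borel (@ms_dist R Z) A ->
      pushforward f A <= pushforward g (nbhd_eps A p) + p /\
      pushforward g A <= pushforward f (nbhd_eps A p) + p] p & p < e.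
  apply: inf_lt; last by apply: le_lt_trans lt_e; rewrite lerDr.
  exact: prokhorov_dist_set_neq0.
have [_ [fg gf]] := hH.
split.
- move=> x; have [|_ [y _ <-] xy] := fg (f x); first by exists x.
  by exists y; rewrite (lt_trans xy).
- move=> y; have [|_ [x _ <-] xy] := gf (g y); first by exists y.
  by exists x; rewrite /c dC (lt_trans xy).
(* The image of [A] might not be Borel in [Z], so the Prokhorov condition is tested on an open
   neighbourhood of it; the radii [e - p] and [p] add up to [e]. *)
- move=> A bA; pose B := nbhd_eps (f @` A) (e - p).
  have [BP _] := pP B (borel_nbhd_eps _ _).
  apply: (@le_trans _ _ (pushforward f B)).
    apply: (borel_measure_le (cm_measure X)) => //.
      by apply: borel_preimage (borel_nbhd_eps _ _) => x y; rewrite fE.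
    move=> x Ax; exists (f x); first by exists x.
    by rewrite (metric_refl mZ) subr_gt0.
  apply: (le_trans BP); apply: lerD (ltW p_e).
  apply: (borel_measure_le (cm_measure Y)).
  + by apply: borel_preimage (borel_nbhd_eps _ _) => x y; rewrite gE.
  + by apply: mopen_borel; exact: (mopen_coupling_r cc).
  + move=> y [w [_ [x Ax <-] wx] yw]; exists x => //.
    by rewrite /c dC; have := dT (g y) w (f x); lra.
- move=> A bA; pose B := nbhd_eps (g @` A) (e - p).
  have [_ BP] := pP B (borel_nbhd_eps _ _).
  apply: (@le_trans _ _ (pushforward g B)).
    apply: (borel_measure_le (cm_measure Y)) => //.
      by apply: borel_preimage (borel_nbhd_eps _ _) => x y; rewrite gE.
    move=> x Ax; exists (g x); first by exists x.
    by rewrite (metric_refl mZ) subr_gt0.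
  apply: (le_trans BP); apply: lerD (ltW p_e).
  apply: (borel_measure_le (cm_measure X)).
  + by apply: borel_preimage (borel_nbhd_eps _ _) => x y; rewrite fE.
  + by apply: mopen_borel; exact: (mopen_coupling_l (cm_metric X) (cm_metric Y) cc).
  + move=> x [w [_ [y Ay <-] wy] xw]; exists y => //.
    by rewrite /c; have := dT (f x) w (g y); lra.
Qed.

(** * Total masses and empty carriers *)

(** In every embedding, the Prokhorov condition is tested on the whole of [Z], which is its own
    neighbourhood. *)
Lemma mass_dist_le_ghp_dist (R : realType) (X Y : cmms R) :
  `|@cm_meas R X setT - @cm_meas R Y setT| <= ghp_dist X Y.
Proof.
apply: lb_le_inf.
  have [Z [f [g [fE gE]]]] := ex_common_embedding X Y.
  by eexists; exists Z, f, g; split.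
move=> _ [Z [f [g [fE gE ->]]]]; rewrite -[leLHS]add0r; apply: lerD.
  by apply: inf_ge0 => t [/ltW].
have NT r : 0 < r -> nbhd_eps [set: Z] r = setT.
  move=> r0; apply/seteqP; split=> // z _; exists z => //.
  by rewrite (metric_refl (ms_metric Z)).
apply: lb_le_inf. exact: prokhorov_dist_set_neq0.
move=> r [r0 /(_ setT (@borelT _ _ _))]; rewrite NT // /pushforward !preimage_setT.
by case=> ? ?; rewrite ler_norml; lra.
Qed.

Lemma ghp_dist_empty (R : realType) (X Y : cmms R) :
  (X -> False) \/ (Y -> False) ->
  ghp_dist X Y <= `|@cm_meas R X setT - @cm_meas R Y setT|.
Proof.
move=> XY0; have [Z [f [g [fE gE]]]] := ex_common_embedding X Y.
apply: (@le_trans _ _ (hausdorff_dist (range f) (range g)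
    + prokhorov_dist (pushforward f) (pushforward g))).
  apply: ge_inf; last by exists Z, f, g; split.
  exists 0 => r [W [f' [g' [_ _ ->]]]].
  by apply: addr_ge0; apply: inf_ge0 => t [/ltW].
rewrite -[leRHS]add0r; apply: lerD; apply/ler_addgt0Pr => e e0.
  (* Either no radius is admissible and the infimum is 0 by default, or both carriers are empty and
     every positive radius is admissible. *)
  rewrite add0r /hausdorff_dist; set S := (X in inf X).
  have [->|/set0P[r [_ [fg gf]]]] := eqVneq S set0; first by rewrite inf0 ltW.
  apply: ge_inf; first by exists 0 => t [/ltW].
  split=> //; split=> [_ [x _ <-]|_ [y _ <-]].
    have [|_ [y _ _] _] := fg (f x); first by exists x.
    by case: XY0; [move=> /(_ x)|move=> /(_ y)].
  have [|_ [x _ _] _] := gf (g y); first by exists y.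
  by case: XY0; [move=> /(_ x)|move=> /(_ y)].
apply: ge_inf; first by exists 0 => t [/ltW].
split=> [|A bA]; first by rewrite ltr_wpDl.
pose m : R := `|@cm_meas R X setT - @cm_meas R Y setT|; rewrite -/m.
have fN := pushforward_ge0 fE (borel_nbhd_eps A (m + e)).
have gN := pushforward_ge0 gE (borel_nbhd_eps A (m + e)).
have fA := pushforward_le fE bA (@borelT _ _ _) (@subsetT _ A).
have gA := pushforward_le gE bA (@borelT _ _ _) (@subsetT _ A).
rewrite {2}/pushforward preimage_setT in fA.
rewrite {2}/pushforward preimage_setT in gA.
have [[_ X0 _] [_ Y0 _]] := (cm_measure X, cm_measure Y).
have f0 := pushforward_ge0 fE bA; have g0 := pushforward_ge0 gE bA.
have m1 : @cm_meas R X setT - @cm_meas R Y setT <= m by exact: ler_norm.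
have m2 : @cm_meas R Y setT - @cm_meas R X setT <= m.
  by rewrite /m distrC; exact: ler_norm.
clearbody m.
(* The empty side has mass 0, so the other total mass is at most [m] and bounds all its sets. *)
have [XT0|YT0] : @cm_meas R X setT = 0 \/ @cm_meas R Y setT = 0.
  case: XY0 => E0; [left; rewrite -X0|right; rewrite -Y0]; congr cm_meas.
    by apply/seteqP; split=> // x; case: (E0 x).
  by apply/seteqP; split=> // y; case: (E0 y).
  by clear XY0; split; lra.
by clear XY0; split; lra.
Qed.

(** * Quotient couplings and the sandwich estimate *)

Section QuotientCoupling.
Variables (R : realType) (V T U : Type).
Variables (dV : V -> V -> R) (d : T -> T -> R) (d' : U -> U -> R).
Variables (p : V -> T) (k : V -> U -> R) (D : R) (v0 : V).
Hypotheses (dm : is_metric d) (dm' : is_metric d') (kc : is_coupling dV d' k).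
Hypotheses (D0 : 0 <= D) (pD : forall u v, dV u v <= d (p u) (p v) + D).
Hypothesis pL : forall u v, d (p u) (p v) <= dV u v.

(** The coupling [k] is carried along [p] by infimal convolution. The added [D] pays for the
    distortion of [p] and, when positive, makes the coupling positive. *)
Definition quotient_coupling (x : T) (y : U) : R :=
  D + inf (range (fun v => d (p v) x + k v y)).

Lemma quotient_coupling_le v x y : quotient_coupling x y <= D + (d (p v) x + k v y).
Proof.
rewrite lerD2l; apply: ge_inf; last by exists v.
exists 0 => _ [u _ <-]; have [k0 _ _ _ _] := kc.
by rewrite addr_ge0 // metric_ge0.
Qed.

Lemma quotient_coupling_ge x y : D <= quotient_coupling x y.
Proof.
rewrite lerDl; apply: inf_ge0 => _ [u _ <-]; have [k0 _ _ _ _] := kc.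
by rewrite addr_ge0 // metric_ge0.
Qed.

Lemma quotient_coupling_approx x y e : 0 < e ->
  exists v, D + (d (p v) x + k v y) < quotient_coupling x y + e.
Proof.
move=> e0; have [||_ [v _ <-] lt_e] :=
    @inf_lt _ (range (fun v => d (p v) x + k v y)) (quotient_coupling x y - D + e).
- by exists (d (p v0) x + k v0 y); exists v0.
- by rewrite /quotient_coupling; lra.
- by exists v; lra.
Qed.

Lemma quotient_coupling_is_coupling : is_coupling d d' quotient_coupling.
Proof.
have [k0 k1 k2 k3 k4] := kc; have [_ dC dT] := dm.
split=> [x y|x x' y|x y y'|x x' y|x y y'].
- exact: le_trans D0 (quotient_coupling_ge x y).
- apply/ler_addgt0Pr => e e0; have e2 : 0 < e / 2 by lra.
  have [v vP] := quotient_coupling_approx x y e2.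
  have [u uP] := quotient_coupling_approx x' y e2.
  have := dT x (p v) x'; have := dT (p v) (p u) x'; have := pL v u.
  by rewrite (dC x (p v)); have := k1 v u y; move: D0; lra.
(* The near-optimal [v] and [u] differ, and going from one to the other in [V] costs [D] more than
   in [T]; the [D] in the definition absorbs this. *)
- apply/ler_addgt0Pr => e e0; have e2 : 0 < e / 2 by lra.
  have [v vP] := quotient_coupling_approx x y e2.
  have [u uP] := quotient_coupling_approx x y' e2.
  have := k2 v y y'; have := k3 v u y'; have := pD v u.
  by have := dT (p v) x (p u); rewrite (dC x (p u)); move: D0; lra.
- apply/ler_addgt0Pr => e e0; have [v vP] := quotient_coupling_approx x' y e0.
  have := quotient_coupling_le v x y; have := dT (p v) x' x.
  by rewrite (dC x' x); lra.
- apply/ler_addgt0Pr => e e0; have [v vP] := quotient_coupling_approx x y' e0.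
  by have := quotient_coupling_le v x y; have := k4 v y y'; lra.
Qed.

End QuotientCoupling.

(* The composite of the correspondences [Xinf ~ Xp], [f] and [Xm ~ Xinf] is an
   almost 1-Lipschitz, almost surjective self-map of [Xinf]. *)
Lemma sandwich_distortion (R : realType) (Xinf : cmms R) (delta : R) : 0 < delta ->
  exists2 h0 : R, 0 < h0 & forall (Xm Xp : cmms R) (f : Xp -> Xm)
    (cm : Xm -> Xinf -> R) (cp : Xp -> Xinf -> R) (h : R), h <= h0 ->
    (forall w, exists v, f v = w) ->
    (forall u v, cm_dist (f u) (f v) <= cm_dist u v) ->
    is_coupling (@cm_dist R Xm) (@cm_dist R Xinf) cm ->
    is_coupling (@cm_dist R Xp) (@cm_dist R Xinf) cp ->
    eps_close cm h -> eps_close cp h ->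
    forall u v, cm_dist u v <= cm_dist (f u) (f v) + (delta + 8 * h).
Proof.
move=> delta0; have [h1 h10 iso] :=
  almost_isometry (cm_metric Xinf) (@cm_compact _ Xinf) delta0.
(* Both the Lipschitz defect and the surjectivity defect of the self-map [s] below are at most
   [4 * h]. *)
exists (h1 / 4); first by lra.
move=> Xm Xp f cm cp h h_le fS fL [_ m1 m2 m3 m4] [_ p1 p2 p3 p4].
move=> [mX mI _ _] [pX pI _ _] u v.
have [_ dC _] := cm_metric Xinf.
have /choice[s sP] z : exists z', exists2 w, cp w z < h & cm (f w) z' < h.
  by have [w wz] := pI z; have [z' wz'] := mX (f w); exists z', w.
have cmP w w' z : cp w z < h -> cp w' z < h -> cm_dist (f w) (f w') < 2 * h.
  by move=> wz wz'; have := fL w w'; have := p1 w w' z; lra.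
have [z uz] := pX u; have [z' vz'] := pX v.
have [u' u'z u's] := sP z; have [v' v'z' v's] := sP z'.
(* Of the loss [8 * h], replacing [u], [v] by [z], [z'] costs [2 * h], and replacing [s z], [s z']
   by [f u], [f v] costs [3 * h] each. *)
have := iso s _ _ z z'.
have sL a b : cm_dist (s a) (s b) <= cm_dist a b + h1.
  have [w wa wsa] := sP a; have [w' wb wsb] := sP b.
  have := m2 (f w) (s a) (s b); have := m3 (f w) (f w') (s b); have := fL w w'.
  by have := p1 w w' a; have := p4 w' a b; rewrite (dC b a); lra.
have sS b : exists a, cm_dist (s a) b <= h1.
  have [w wb] := mI b; have [t tw] := fS w; have [a ta] := pX t; exists a.
  have [t' t'a t's] := sP a; rewrite -tw in wb.
  have := m2 (f t) (s a) b; have := m3 (f t) (f t') (s a).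
  by have := cmP _ _ _ ta t'a; lra.
move=> /(_ sL sS).
have := p1 u v z; have := p4 v z z'; rewrite (dC z' z).
have := m2 (f u) (s z) (s z').
have := m3 (f u) (f u') (s z); have := cmP _ _ _ uz u'z.
have := m3 (f v) (f v') (s z'); have := cmP _ _ _ vz' v'z'.
by have := m3 (f u) (f v) (s z'); lra.
Qed.

Lemma ghp_dist_sandwich (R : realType) (Xinf : cmms R) (e : R) : 0 < e ->
  exists2 h : R, 0 < h & forall Xm X Xp : cmms R,
    cmms_le Xm X -> cmms_le X Xp ->
    ghp_dist Xm Xinf < h -> ghp_dist Xp Xinf < h -> ghp_dist X Xinf < e.
Proof.
move=> e0; have delta0 : 0 < e / 8 by lra.
have [h0 h00 distortion] := sandwich_distortion Xinf delta0.
(* The final bound is twice [e / 8 + 12 * h], at most [5 * e / 8]. *)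
pose h := Num.min h0 (e / 64); exists h; first by rewrite lt_min h00; lra.
have h_h0 : h <= h0 by rewrite ge_min lexx.
have h_e : h <= e / 64 by rewrite ge_min lexx orbT.
have hpos : 0 < h by rewrite lt_min h00; lra.
clearbody h; move=> Xm X Xp [q [qS qL qm]] [p [pS pL pm]] mh ph.
have massm := le_lt_trans (mass_dist_le_ghp_dist Xm Xinf) mh.
have massp := le_lt_trans (mass_dist_le_ghp_dist Xp Xinf) ph.
have := qm _ (@borelT _ _ _); have := pm _ (@borelT _ _ _).
rewrite !preimage_setT => massXp massmX.
move: massm massp; rewrite !ltr_norml => /andP[massm1 massm2] /andP[massp1 massp2].
(* With an empty carrier only masses count, and that of [X] lies between those of [Xm] and [Xp],
   both within [h] of that of [Xinf]. *)
have [[X0 XI0]|empty] := pselect (inhabited X /\ inhabited Xinf); last first.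
  apply: le_lt_trans (ghp_dist_empty _) _; last by rewrite ltr_norml; lra.
  have [X0|X0] := pselect (inhabited X); last by left => x; exact: X0 (inhabits x).
  right => z; apply: empty; split=> //; exact: inhabits z.
case: X0 => x0; case: XI0 => z0; have [v0 pv0] := pS x0.
have [cm cmc cmh] := ghp_dist_lt (q x0) z0 mh.
have [cp cpc cph] := ghp_dist_lt v0 z0 ph.
have := distortion Xm Xp (q \o p) cm cp h h_h0 _ _ cmc cpc cmh cph.
pose D := e / 8 + 8 * h; rewrite -/D => pD.
(* Since [q] is 1-Lipschitz, the distortion bound for [q \o p] passes to [p]. *)
have {}pD u v : cm_dist u v <= cm_dist (p u) (p v) + D.
  apply: le_trans (pD _ _ u v) _ => [w|a b|].
  - by have [x <-] := qS w; have [a <-] := pS x; exists a.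
  - exact: le_trans (qL _ _) (pL _ _).
  - by rewrite lerD2r; exact: qL.
have D0 : 0 < D by rewrite /D; lra.
pose c := quotient_coupling (@cm_dist R X) p cp D.
have cc : is_coupling (@cm_dist R X) (@cm_dist R Xinf) c.
  exact: (quotient_coupling_is_coupling v0 (cm_metric X) cpc (ltW D0) pD pL).
have cpos x z : 0 < c x z.
  exact: lt_le_trans D0 (quotient_coupling_ge p D (cm_metric X) cpc x z).
have cle v z : cp v z < h -> c (p v) z < e / 8 + 12 * h.
  move=> vz; have := quotient_coupling_le p D (cm_metric X) cpc v (p v) z.
  by rewrite (metric_refl (cm_metric X)) -/c /D; lra.
suff cE : eps_close c (e / 8 + 12 * h).
  apply: le_lt_trans (ghp_dist_le _ cc cpos cE) _; lra.
have [XpI IXp mXp mI] := cph.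
have bp A : borel (@cm_dist R X) A -> borel (@cm_dist R Xp) (p @^-1` A).
  exact: borel_preimage.
split.
- by move=> x; have [v <-] := pS x; have [z vz] := XpI v; exists z; exact: cle.
- by move=> z; have [v vz] := IXp z; exists (p v); exact: cle.
- move=> A bA; apply: (le_trans (pm A bA)); apply: (le_trans (mXp _ (bp A bA))).
  apply: lerD; last by lra.
  apply: (borel_measure_le (cm_measure Xinf)).
  + by apply: mopen_borel; exact: (mopen_coupling_r cpc).
  + by apply: mopen_borel; exact: (mopen_coupling_r cc).
  + by move=> z [v Av vz]; exists (p v) => //; exact: cle.
- move=> B bB; set C := [set x | _].
  have bC : borel (@cm_dist R X) C.
    apply: mopen_borel.
    exact: (mopen_coupling_l (cm_metric X) (cm_metric Xinf) cc).
  have : cm_meas [set v | exists2 z, B z & cp v z < h] <= cm_meas (p @^-1` C).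
    apply: (borel_measure_le (cm_measure Xp)); [|exact: bp|].
      apply: mopen_borel.
      exact: (mopen_coupling_l (cm_metric Xp) (cm_metric Xinf) cpc).
    by move=> v [z Bz vz]; exists z => //; exact: cle.
  (* On the complement of [C], measure contraction gives the reverse bound on [C] up to the mass
     difference of [Xp] and [X], below [2 * h]. *)
  have := mI B bB; have := pm _ (borelC bC).
  rewrite preimage_setC (borel_measureC (cm_measure X)) //.
  rewrite (borel_measureC (cm_measure Xp)); last exact: bp bC.
  lra.
Qed.

Theorem theorem1p2 (R : realType) :
  (* <| is a well-defined partial order on measure-preserving isometry classes *)
  ((forall X X' Y Y' : cmms R, cmms_iso X X' -> cmms_iso Y Y' ->
      (cmms_le X Y <-> cmms_le X' Y')) /\
   (forall X : cmms R, cmms_le X X) /\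
   (forall X Y Z : cmms R, cmms_le X Y -> cmms_le Y Z -> cmms_le X Z) /\
   (forall X Y : cmms R, cmms_le X Y -> cmms_le Y X -> cmms_iso X Y)) /\
  (* sandwich theorem *)
  (forall (Xm X Xp : nat -> cmms R) (Xinf : cmms R),
     (forall n, cmms_le (Xm n) (X n) /\ cmms_le (X n) (Xp n)) ->
     ghp_cvg Xm Xinf -> ghp_cvg Xp Xinf -> ghp_cvg X Xinf).
Proof.
split; first split; [|split; [|split]|].
- exact: cmms_le_iso.
- exact: cmms_le_refl.
- exact: cmms_le_trans.
- exact: cmms_le_antisym.
move=> Xm X Xp Xinf le /cvgrPdist_lt cvgm /cvgrPdist_lt cvgp.
have norm_ghp Y : `|0 - ghp_dist Y Xinf| = ghp_dist Y Xinf.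
  rewrite sub0r normrN ger0_norm //.
  exact: le_trans (normr_ge0 _) (mass_dist_le_ghp_dist _ _).
apply/cvgrPdist_lt => e e0; have [h h0 sandwich] := ghp_dist_sandwich Xinf e0.
near=> n; rewrite norm_ghp; have [leXm leXp] := le n.
apply: (sandwich _ _ _ leXm leXp); rewrite -norm_ghp; near: n.
- exact: cvgm.
- exact: cvgp.
Unshelve. all: by end_near.
Qed.
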